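(* Let $E$ be a Banach space and let $B$ be a bounded subset of $E^{\ast}$ with $0 \notin K := \overline{\operatorname{co}(B)}^{\omega^{\ast}}$ satisfying: for every $x \in L_{K}$ there is $b^{\ast} \in B$ with $\langle x, b^{\ast}\rangle = \sup_{c^\ast\in B}\langle x,c^\ast\rangle = \sup_{c^\ast\in K}\langle x,c^\ast\rangle$. If $(x_{n})_{n \in \mathbb{N}}$ is a bounded sequence in $E$ which $\sigma(E,B)$-converges to $0$, then it is $\sigma(E,K)$-convergent to $0$.
   Context: Banach spaces are real. $\operatorname{co}(B)$ is the convex hull of $B$ and $\overline{S}^{\omega^\ast}$ is the weak$^\ast$ ($\sigma(E^\ast,E)$) closure of $S$ in $E^\ast$. For $K\subset E^\ast$: if $K\neq\emptyset$, $L_K := \{x \in E : \sup_{k^\ast\in K}\langle x,k^\ast\rangle < 0\}$; $L_\emptyset := E\setminus\{0\}$. For $S\subset E^\ast$, $\sigma(E,S)$ is the topology on $E$ of pointwise convergence on $S$. *)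

(* Defs.v *)
From HB Require Import structures.
From mathcomp Require Import all_boot all_order all_algebra.
From mathcomp Require Import all_classical all_reals all_analysis.

Set Implicit Arguments.
Unset Strict Implicit.
Unset Printing Implicit Defensive.

Import Order.TTheory GRing.Theory Num.Theory.
Import numFieldNormedType.Exports.

Local Open Scope classical_set_scope.
Local Open Scope ring_scope.

Section Dual.
Context {R : realType} (E : normedModType R).

Definition continuous_functional : {pred E -> R^o} :=
  fun f => `[< linear f /\ continuous f >].

Record dual : Type := Dual {
  dual_val :> E -> R^o ;
  dual_valP : dual_val \in continuous_functional }.

HB.instance Definition _ := [isSub for dual_val].
HB.instance Definition _ := [Choice of dual by <:].

Fact continuous_functional_submod : submod_closed continuous_functional.
Proof.
split.
  apply/asboolP; split; last exact: cst_continuous.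
  by move=> a u v; rewrite [RHS]addr0 scaler0.
move=> a f g /asboolP[lf cf] /asboolP[lg cg]; apply/asboolP; split.
  move=> b u v; rewrite !fctE lf lg !scalerDr addrACA !scalerA.
  by rewrite [a * b]mulrC.
by move=> x; apply: cvgD; [apply: cvgZl_tmp; exact: cf|exact: cg].
Qed.

HB.instance Definition _ := GRing.isSubmodClosed.Build R (E -> R^o)
  continuous_functional continuous_functional_submod.
HB.instance Definition _ := [SubChoice_isSubLmodule of dual by <:].

Implicit Types f g : dual.

Fact dual_linear f : linear f.
Proof. by case: f => f /= /asboolP[]. Qed.

HB.instance Definition _ f :=
  GRing.isLinear.Build R E R^o _ (dual_val f) (@dual_linear f).

Lemma dual_continuous f : continuous f.
Proof. by case: f => f /= /asboolP[]. Qed.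

Lemma dualDE f g x : (f + g) x = f x + g x. Proof. by []. Qed.

Lemma dualZE (a : R) f x : (a *: f) x = a *: f x. Proof. by []. Qed.

Definition dual_norm f : R := sup [set `|f x| | x in [set x : E | `|x| <= 1]].

Let values f : set R := [set `|f x| | x in [set x : E | `|x| <= 1]].

Let values0 f : values f 0.
Proof. by exists 0; rewrite /= ?normr0 ?ler01// linear0 normr0. Qed.

Let has_sup_values f : has_sup (values f).
Proof.
split; first by exists 0; exact: values0.
have /(continuous_linear_bounded 0)/bounded_funP/(_ 1)[M fM] :=
  @dual_continuous f 0.
by exists M => _ [x x1 <-]; exact: fM.
Qed.

Lemma dual_norm_ge0 f : 0 <= dual_norm f.
Proof. by apply: (sup_upper_bound (has_sup_values f)); exact: values0. Qed.

Lemma dual_norm_ub f x : `|f x| <= dual_norm f * `|x|.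
Proof.
have [->|x0] := eqVneq x 0; first by rewrite linear0 !normr0 mulr0.
have nx0 : 0 < `|x| by rewrite normr_gt0.
rewrite -ler_pdivrMr//; apply: (sup_upper_bound (has_sup_values f)).
exists (`|x|^-1 *: x).
  by rewrite /= normrZ normfV normr_id mulVf ?gt_eqF.
by rewrite linearZ/= normrZ normfV normr_id mulrC.
Qed.

Lemma dual_norm_le f (M : R) : 0 <= M ->
  (forall x, `|f x| <= M * `|x|) -> dual_norm f <= M.
Proof.
move=> M0 fM; apply: ge_sup; first by exists 0; exact: values0.
by move=> _ [x x1 <-]; rewrite (le_trans (fM x))// ler_piMr.
Qed.

Fact dual_ler_normD f g : dual_norm (f + g) <= dual_norm f + dual_norm g.
Proof.
apply: dual_norm_le; first by rewrite addr_ge0 ?dual_norm_ge0.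
move=> x; rewrite dualDE (le_trans (ler_normD _ _))// mulrDl.
by rewrite lerD ?dual_norm_ub.
Qed.

Fact dual_normrZ (a : R) f : dual_norm (a *: f) = `|a| * dual_norm f.
Proof.
have leZ b h : dual_norm (b *: h) <= `|b| * dual_norm h.
  apply: dual_norm_le; first by rewrite mulr_ge0 ?dual_norm_ge0.
  by move=> x; rewrite dualZE normrZ -mulrA ler_wpM2l ?dual_norm_ub.
apply/eqP; rewrite eq_le leZ/=.
have [->|a0] := eqVneq a 0; first by rewrite normr0 mul0r dual_norm_ge0.
rewrite -ler_pdivlMl ?normr_gt0// -normfV.
by rewrite -[in leLHS](scalerK a0 f) leZ.
Qed.

Fact dual_normr0_eq0 f : dual_norm f = 0 -> f = 0.
Proof.
move=> f0; apply/val_inj/funext => x; apply/eqP.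
by rewrite -normr_le0 (le_trans (dual_norm_ub f x))// f0 mul0r.
Qed.

HB.instance Definition _ := Lmodule_isNormed.Build R dual
  dual_ler_normD dual_normrZ dual_normr0_eq0.

(* sigma(E^*, E): [dual] itself carries the topology of the dual norm, so the
   weak-star topology is put on an alias of it. *)
Definition weak_star : Type :=
  initial_topology (fun f : dual => (f : E -> R^o) : {ptws E -> R^o}).

HB.instance Definition _ := Topological.on weak_star.

(* sigma(E, S): E with the topology of pointwise convergence on S, where x acts
   on S by s |-> s x. *)
Definition weak_on (S : set dual) : Type :=
  initial_topology
    (fun x : E => (fun s : S => set_val s x) : {ptws S -> R^o}).

HB.instance Definition _ (S : set dual) := Topological.on (weak_on S).

Definition convex_hull (B : set dual) : set dual :=
  smallest (@convex_set R dual) B.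

Definition weak_star_closure (S : set dual) : set dual :=
  closure (S : set weak_star).

(* sup_{c in C} <x, c>, taken in the extended reals because C may be empty or
   unbounded; it is -oo on the empty set, hence the case split in [L_]. *)
Definition sup_on (C : set dual) (x : E) : \bar R :=
  ereal_sup [set (c x)%:E | c in C].

Definition L_ (K : set dual) : set E :=
  [set x | (K !=set0 /\ (sup_on K x < 0)%E) \/ (K = set0 /\ x != 0)].

End Dual.

(* Main.v *)
Require Import Defs.
From mathcomp Require Import all_boot all_order all_algebra.
From mathcomp Require Import all_classical all_reals all_analysis.
From mathcomp Require Import ring lra.

Import Order.TTheory GRing.Theory Num.Theory.
Import numFieldNormedType.Exports.

Local Open Scope classical_set_scope.
Local Open Scope ring_scope.

(** Let h be the support function of K, that is h x = sup_(k in K) k x.  It is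
sublinear and Lipschitz, and the assumption on B says that at every point where
h < 0 the supremum is attained by an element of B.  As 0 is not in K, Hahn-Banach
([weak_star_separation]) gives a point x0 with h x0 < 0.

Suppose that k (u n) >= e > 0 for some k in K and infinitely many n, where u is
bounded and tends to 0 pointwise on B.  Let C N be the convex hull of the u n
with n >= N and k (u n) >= e; the elements of C N are small at each b in B once N
is large.  The claim ([sublinear_perturbation_neg]) is that for every T >= 0 some
y in C 0 satisfies h (x0 + T y) <= h x0 / 2 < 0.  For T = - k x0 / e this
contradicts h (x0 + T y) >= k x0 + T k y >= 0.

The claim holds for T = 0, and T can be increased by steps of a fixed length r.
Suppose that it holds for a in every C N, so that the convex sets
Y n = {y in C n | h (x0 + a y) <= h x0 / 2} are nonempty.  If r is small with
respect to h x0, the Lipschitz bound gives h (x0 + (a + r) y) <= h x0 / 4 for all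
y in Y 0: the points x0 + (a + r) y, and the infinite convex combinations of them,
stay in the region where the supremum is attained on B.  Simons' inequality
([simons_inequality]) then applies to them.  Each b in B takes values at most
about b x0 <= h x0 at x0 + (a + r) y for y in Y n and n large, so the infimum of
h (x0 + (a + r) y) over the convex set Y 0 is at most about h x0.  This is the
claim for a + r: each application of Simons' inequality restores the margin that
the step has consumed, which is why attainment in the cone h < 0 alone suffices
to go arbitrarily far. *)

Set Implicit Arguments.
Unset Strict Implicit.
Unset Printing Implicit Defensive.

(** * Convex sets *)

Lemma convex_setP (R : realType) (V : lmodType R) (A : set V) :
  @convex_set R V A <->
  (forall x y (a b : R), 0 <= a -> 0 <= b -> a + b = 1 -> A x -> A y ->
     A (a *: x + b *: y)).
Proof.
split=> [cA x y a b a0 b0 ab1 Ax Ay|cA x y l /set_mem Ax /set_mem Ay].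
  have a1 : a <= 1 by rewrite -ab1 lerDl.
  have := cA x y (Itv01 a0 a1) (mem_set Ax) (mem_set Ay).
  by move=> /set_mem; rewrite (_ : b = 1 - a)// -ab1 addrC addKr.
apply/mem_set; apply: cA => //.
  by rewrite subr_ge0.
by rewrite addrC subrK.
Qed.

Lemma convex_comb_le (R : realType) (a b x y r : R) :
  0 <= a -> 0 <= b -> a + b = 1 -> x <= r -> y <= r -> a * x + b * y <= r.
Proof.
move=> a0 b0 ab xr yr; have -> : r = a * r + b * r by rewrite -mulrDl ab mul1r.
by apply: lerD; apply: ler_wpM2l.
Qed.

Lemma smallest_convex (R : realType) (V : lmodType R) (A : set V) :
  @convex_set R V (smallest (@convex_set R V) A).
Proof.
apply/convex_setP => x y a b a0 b0 ab1 Ax Ay C [cC AC].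
by move/convex_setP : (cC); apply => //; [exact: Ax|exact: Ay].
Qed.

Lemma dual_comb (R : realType) (E : normedModType R) (f : dual E) (a b : R)
  (x y : E) : f (a *: x + b *: y) = a * f x + b * f y :> R.
Proof. by rewrite linearD !linearZ. Qed.

(** * Weak topologies *)

Lemma cvg_initialP (S : choiceType) (T : topologicalType) (f : S -> T)
    (F : set_system S) (s : S) : Filter F ->
  F --> (s : initial_topology f) <-> f @ F --> f s.
Proof.
move=> FF; split=> [Fs|fFs].
  by move=> A fsA; apply: Fs; exact: (@initial_continuous _ _ f s).
move=> A /= [_ [[B Bop <-] Bfs sBfA]].
by apply: filterS sBfA _; apply: fFs; exact: open_nbhs_nbhs.
Qed.

Lemma cvg_weak_onP (R : realType) (E : normedModType R) (S : set (dual E))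
    (u : nat -> E) (l : E) :
  (u : nat -> weak_on S) @ \oo --> (l : weak_on S) <->
  forall f, S f -> f (u n) @[n --> \oo] --> f l.
Proof.
rewrite cvg_initialP pointwise_cvgP; split=> [h f Sf|h t].
  by have := h (SigSub (mem_set Sf)).
exact: (h _ (set_valP t)).
Qed.

(** The finitely many conditions indexed by s describe a basic neighbourhood of
f.  That such sets form a basis is seen through the filter F which they generate:
F converges to f because it does so at each point, so every neighbourhood of f
belongs to F. *)
Lemma weak_star_closureP (R : realType) (E : normedModType R)
    (S : set (dual E)) (f : dual E) :
  weak_star_closure S f <->
  forall (s : seq E) (e : R), 0 < e ->
    exists2 g, S g & forall x, x \in s -> `|g x - f x| < e.
Proof.
split=> [Sf s e e0|h V Vf].
  have : nbhs (f : weak_star E)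
      [set g : dual E | forall x, x \in s -> `|g x - f x| < e].
    elim: s => [|x s IH]; first by apply: filterS filterT.
    have ev : (fun g : weak_star E => (g : dual E) x : R^o) @ (nbhs (f : weak_star E))
        --> (f x : R^o).
      have := @cvg_id _ (nbhs (f : weak_star E)).
      by move/cvg_initialP/pointwise_cvgP => /(_ x).
    have /cvgrPdist_lt/(_ _ e0) fx := ev.
    apply: filterS2 IH fx => g gs gx y; rewrite inE => /orP[/eqP->|/gs//].
    by rewrite distrC.
  by move=> /Sf[g [Sg gV]]; exists g.
pose U (p : seq E * R) :=
  [set g : dual E | forall x, x \in p.1 -> `|g x - f x| < p.2].
pose F := filter_from [set p : seq E * R | 0 < p.2] U.
have FF : Filter F.
  apply: filter_from_filter; first by exists ([::], 1) => /=.
  move=> [s e] [s' e'] /= e0 e0'; exists (s ++ s', Order.min e e').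
    by rewrite /= lt_min e0 e0'.
  move=> g; rewrite /U /= => gU.
  by split=> x xs; have := gU x; rewrite mem_cat xs ?orbT lt_min => /(_ isT)/andP[].
have : F --> (f : weak_star E).
  apply/cvg_initialP/pointwise_cvgP => x; apply/cvgrPdist_lt => e e0 /=.
  rewrite nbhs_filterE; exists ([:: x], e) => //= g gU /=.
  by rewrite distrC gU// inE.
move=> /(_ _ Vf)[[s e] /= e0 UV].
by have [g Sg gs] := h s e e0; exists g; split=> //; exact: UV.
Qed.

Lemma sub_weak_star_closure (R : realType) (E : normedModType R)
    (S : set (dual E)) : S `<=` weak_star_closure S.
Proof. exact: (@subset_closure (weak_star E)). Qed.

(** * Separating 0 from a weak-star closed convex set *)

(** Finitely many points s witness that 0 is not in the closure, so the problem
lives in the Euclidean space of the values on s.  If a is almost a vector of least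
norm in the convex set of values, then the inner product of a with every f in S is
bounded below: otherwise moving from a slightly towards f would decrease the norm.
The vector - \sum_(x <- s) a x *: x therefore separates.  The bound on S makes the
choice of a independent of f. *)
Lemma weak_star_separation (R : realType) (E : normedModType R)
    (S : set (dual E)) :
  @convex_set R (dual E) S ->
  (forall x : E, exists M : R, forall f, S f -> `|f x| <= M) ->
  ~ weak_star_closure S 0 ->
  exists x : E, exists2 d : R, 0 < d & forall f, S f -> f x <= - d.
Proof.
move=> /convex_setP cS bS S0.
have [[s e] /= e0 far] : exists2 p : seq E * R, 0 < p.2 &
    forall f, S f -> exists2 x, x \in p.1 & p.2 <= `|f x|.
  apply: contrapT => near0; apply: S0; apply/weak_star_closureP => s e e0.
  apply: contrapT => nos; apply: near0; exists (s, e) => //= f Sf.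
  apply: contrapT => nox; apply: nos; exists f => // x xs.
  rewrite subr0 ltNge; apply/negP => efx; apply: nox.
  by exists x.
pose ip (f g : dual E) : R := \sum_(x <- s) f x * g x.
have [D D0 qD] : exists2 D : R, 0 < D & forall f, S f -> ip f f <= D.
  have [M bM] := choice bS.
  exists (1 + \sum_(x <- s) (M x) ^+ 2).
    by rewrite ltr_pwDl// sumr_ge0// => x _; exact: sqr_ge0.
  move=> f Sf; apply: (@le_trans _ _ (\sum_(x <- s) (M x) ^+ 2)); last first.
    by rewrite lerDr.
  apply: ler_sum => x _; rewrite -expr2 -[leLHS]real_normK ?num_real//.
  by rewrite lerXn2r ?nnegrE// ?bM// (le_trans _ (bM x _ Sf)).
have qe f : S f -> e ^+ 2 <= ip f f.
  move=> Sf; have [x xs ex] := far f Sf.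
  have ns y : 0 <= (f y : R) * f y by rewrite -expr2 sqr_ge0.
  rewrite /ip (big_rem x)//= ler_wpDr ?sumr_ge0//.
  rewrite -expr2 -[leRHS]real_normK ?num_real//.
  by rewrite lerXn2r ?nnegrE// ltW.
have [S_empty|/set0P[f0 Sf0]] := eqVneq S set0.
  by exists 0, 1 => // f; rewrite S_empty.
pose Q := [set ip f f | f in S].
have Qlb : has_inf Q.
  by split; [exists (ip f0 f0); exists f0|exists (e ^+ 2) => _ [f Sf <-]; exact: qe].
pose d := inf Q.
have d0 : 0 < d.
  apply: (@lt_le_trans _ _ (e ^+ 2)); first by rewrite exprn_gt0.
  by apply: lb_le_inf => [|_ [f Sf <-]]; [case: Qlb|exact: qe].
have dQ f : S f -> d <= ip f f.
  by move=> Sf; apply: ge_inf; [case: Qlb|exists f].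
have dD : d <= D by rewrite (le_trans (dQ _ Sf0))// qD.
(* t is the length of the move towards f and t d / 2 the precision to which a
   minimizes; the errors t ^+ 2 * d, t ^+ 2 * ip f f and t * d / 2 then add up to
   at most half of the gain 2 * t * d. *)
pose t := d / (4 * D).
have t0 : 0 < t by rewrite divr_gt0// mulr_gt0.
have tD : t * D = d / 4 by rewrite /t; field; rewrite gt_eqF.
have t1 : t <= 1 / 4 by rewrite /t ler_pdivrMr ?mulr_gt0//; lra.
have [_ [a Sa <-] aQ] : exists2 r, Q r & r < d + t * d / 2.
  by apply: inf_adherent => //; rewrite divr_gt0// mulr_gt0.
exists (- \sum_(x <- s) (a x : R) *: x), (d / 2); first by rewrite divr_gt0.
move=> f Sf.
have -> : f (- \sum_(x <- s) (a x : R) *: x) = - ip a f :> R.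
  rewrite linearN linear_sum; congr (- _).
  by apply: eq_bigr => x _; rewrite linearZ.
rewrite lerN2.
have := dQ _ (cS a f (1 - t) t ltac:(lra) (ltW t0) ltac:(lra) Sa Sf).
have -> : ip ((1 - t) *: a + t *: f) ((1 - t) *: a + t *: f) =
    (1 - t) ^+ 2 * ip a a + 2 * t * (1 - t) * ip a f + t ^+ 2 * ip f f.
  rewrite /ip !mulr_sumr -!big_split /=; apply: eq_bigr => x _.
  transitivity (((1 - t) * a x + t * f x) ^+ 2 : R); first by [].
  ring.
have := qD _ Sf; have := dQ _ Sa.
move: (ip a a) (ip a f) (ip f f) aQ => u v w uQ du wD dle.
have tw : t * (t * w) <= t * (d / 4) by rewrite ler_pM2l// -tD ler_pM2l.
have tt : (1 - t) ^+ 2 <= 1 by rewrite expr_le1 //; lra.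
have ud : (1 - t) ^+ 2 * u <= (1 - t) ^+ 2 * d + t * d / 2.
  have : (1 - t) ^+ 2 * u <= (1 - t) ^+ 2 * (d + t * d / 2).
    by rewrite ler_wpM2l ?sqr_ge0// ltW.
  have : (1 - t) ^+ 2 * (t * d / 2) <= 1 * (t * d / 2).
    by rewrite ler_wpM2r// divr_ge0// mulr_ge0// ltW.
  lra.
have ttd : t * (t * d) <= 1 / 4 * (t * d).
  by rewrite ler_wpM2r// mulr_ge0// ltW.
have key : d / 2 <= (1 - t) * v.
  by rewrite -(ler_pM2l t0); lra.
have v0 : 0 < v.
  by rewrite -(@pmulr_rgt0 _ (1 - t)); lra.
have : 0 <= t * v by rewrite mulr_ge0// ltW.
lra.
Qed.

(** * Simons' inequality *)

(** Sum the increments over n >= N; the proof uses that a n + 2 r / 2 ^ n is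
nondecreasing from N on and has the same limit as a. *)
Lemma geometric_increment_le (R : realType) (a : nat -> R) (l r : R) (N : nat) :
  (forall n, (N <= n)%N -> r * 2^-1 ^+ n <= a n.+1 - a n) ->
  a n @[n --> \oo] --> l -> r * 2 * 2^-1 ^+ N <= l - a N.
Proof.
move=> ra al.
pose c n := a n + r * 2 * 2^-1 ^+ n.
have cl : c n @[n --> \oo] --> l.
  rewrite -[l]addr0; apply: cvgD => //.
  rewrite -(mulr0 (r * 2)); apply: cvgMr; apply: cvg_expr.
  by rewrite ger0_norm; lra.
have mono m : c N <= c (N + m)%N.
  elim: m => [|m IH]; first by rewrite addn0.
  apply: (le_trans IH); rewrite addnS /c exprS.
  have := ra _ (leq_addr m N); lra.
have : c N <= l.
  apply: (cvgr_to_ge cl); exists N => // n /= Nn.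
  by rewrite -(subnKC Nn).
rewrite /c; lra.
Qed.

Definition sublinear (R : realType) (E : lmodType R) (h : E -> R) :=
  (forall x y, h (x + y) <= h x + h y) /\
  (forall a x, 0 <= a -> h (a *: x) = a * h x).

Lemma sublinear_lipschitz (R : realType) (E : normedModType R) (h : E -> R)
    (L : R) : sublinear h -> (forall x, h x <= L * `|x|) ->
  forall x y, h x <= h y + L * `|x - y|.
Proof.
by move=> [hD _] hL x y; rewrite -{1}(subrKC y x) (le_trans (hD _ _))// lerD2l.
Qed.

Lemma sublinear_cvg (R : realType) (E : normedModType R) (h : E -> R)
    (L : R) : 0 <= L -> sublinear h -> (forall x, h x <= L * `|x|) ->
  forall (u : nat -> E) v, u n @[n --> \oo] --> v ->
  h (u n) @[n --> \oo] --> h v.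
Proof.
move=> L0 subh hL u v /cvgrPdist_lt uv; apply/cvgrPdist_lt => e e0.
have := uv (e / (L + 1)) (divr_gt0 e0 (ltr_wpDl L0 ltr01)).
apply: filterS => n; rewrite ltr_pdivlMr ?ltr_wpDl// => vun.
have := sublinear_lipschitz subh hL v (u n).
have := sublinear_lipschitz subh hL (u n) v.
rewrite (distrC (u n)) ltr_norml => h1 h2.
have : 0 <= `|v - u n| by [].
by move=> ?; apply/andP; split; lra.
Qed.

(** Suppose that h >= s on C 0.  Build v n = \sum_(i < n) 2 ^- i *: g i, where
g n in C n almost minimizes h (v n + 2 ^- n *: x) over x in C n.  Comparing g n
with the convex combination (2 g n + g n.+1) / 3, which sends the new point to
v n / 3 + 2 v n.+2 / 3, shows that each increment of h along v is at least about
half of the previous one; as the first one is h (g 0) >= s, the n-th one is at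
least about s / 2 ^ n.  At the limit w of v the value h w is attained by some b in
B.  The tail of h along v then bounds from below the tail of b, which is at most
t times a geometric tail as b <= t on C N.  Hence s <= t, up to the slack th.
The point w is twice an infinite convex combination of elements of C 0, so h <= - c
on C 0 ensures that h w < 0, where attainment is available. *)
Lemma simons_inequality (R : realType) (E : completeNormedModType R)
    (h : E -> R) (L : R) (B : set (dual E)) (C : nat -> set E) (M c t s : R) :
  0 <= L -> sublinear h -> (forall x, h x <= L * `|x|) ->
  (forall b x, B b -> b x <= h x) ->
  (forall x, h x < 0 -> exists2 b, B b & b x = h x :> R) ->
  (forall n, @convex_set R E (C n)) -> (forall n, C n !=set0) ->
  (forall m n, (m <= n)%N -> C n `<=` C m) ->
  (forall x, C 0%N x -> `|x| <= M) ->
  0 < c -> (forall x, C 0%N x -> h x <= - c) ->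
  (forall b, B b -> exists N, forall x, C N x -> b x <= t) ->
  t < s -> exists2 x, C 0%N x & h x < s.
Proof.
move=> L0 subh hL Bh attain cC C0 Cdecr CM c0 hc Bt ts.
have [hD hZ] := subh.
apply: contrapT => noC.
have hs x : C 0%N x -> s <= h x.
  by move=> Cx; rewrite leNgt; apply/negP => hx; apply: noC; exists x.
pose th := (s - t) / 2.
have th0 : 0 < th by rewrite divr_gt0// subr_gt0.
have C0n n : C n `<=` C 0%N by exact: Cdecr.
pose q n : R := 2^-1 ^+ n.
have q0 n : 0 < q n by rewrite exprn_gt0// invr_gt0.
have qS n : q n.+1 = q n / 2 by rewrite /q exprSr.
(* The tolerance th * q n ^+ 2 / 6 is what makes the induction for incr close. *)
have near_min (p : nat * E) : exists g, C p.1 g /\ forall g', C p.1 g' ->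
    h (p.2 + q p.1 *: g) <= h (p.2 + q p.1 *: g') + th * (q p.1) ^+ 2 / 6.
  case: p => n v /=.
  pose S := [set h (v + q n *: g) | g in C n].
  have Sinf : has_inf S.
    split; first by have [g Cg] := C0 n; exists (h (v + q n *: g)); exists g.
    exists (- h (- v) + q n * s) => _ [g Cg <-].
    have := hD (- v) (v + q n *: g); rewrite addKr (hZ _ _ (ltW (q0 n))).
    have : q n * s <= q n * h g by rewrite ler_pM2l// hs//; exact: C0n Cg.
    lra.
  have e0 : 0 < th * (q n) ^+ 2 / 6.
    by rewrite divr_gt0// mulr_gt0// exprn_gt0.
  have [_ [g Cg <-] gS] := inf_adherent e0 Sinf.
  exists g; split=> // g' Cg'; rewrite (le_trans (ltW gS))// lerD2r.
  by apply: ge_inf; [case: Sinf|exists g'].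
have [G GP] := choice near_min.
pose v := fix v n := if n is m.+1 then v m + q m *: G (m, v m) else 0.
pose g n := G (n, v n).
have vS n : v n.+1 = v n + q n *: g n by [].
have Cg n : C n (g n) by have [] := GP (n, v n).
have gmin n x : C n x -> h (v n.+1) <= h (v n + q n *: x) + th * (q n) ^+ 2 / 6.
  by move=> Cx; have [_ gG] := GP (n, v n); exact: gG.
have h0 : h 0 = 0 by rewrite -(scale0r 0) hZ// mul0r.
have incr n : (s - th + th * q n) * q n <= h (v n.+1) - h (v n).
  elim: n => [|n IH].
    rewrite vS /= /q expr0 scale1r add0r h0.
    by have := hs _ (Cg 0%N); lra.
  have gn1 : C n (g n.+1) by exact: (Cdecr n n.+1 (leqnSn n) _ (Cg n.+1)).
  have [a0 b0 ab] : [/\ 0 <= 2 / 3 :> R, 0 <= 1 / 3 :> R & 2 / 3 + 1 / 3 = 1 :> R].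
    by split; lra.
  have Cu := (convex_setP (C n)).1 (cC n) _ _ _ _ a0 b0 ab (Cg n) gn1.
  have := gmin n _ Cu.
  have -> : v n + q n *: (2 / 3 *: g n + 1 / 3 *: g n.+1) =
      (1 / 3) *: v n + (2 / 3) *: v n.+2.
    rewrite !vS qS !scalerDr !scalerA !addrA -scalerDl (addrC (1 / 3)) ab scale1r.
    by congr (_ + _ *: _ + _ *: _); lra.
  move=> key.
  have := hD ((1 / 3) *: v n) ((2 / 3) *: v n.+2).
  rewrite (hZ _ _ a0) (hZ _ _ b0) => key2.
  rewrite qS; lra.
have vcvg : cvgn v.
  have vE : v = series (fun n => q n *: g n).
    apply/funext => n; elim: n => [|n IH]; first by rewrite /series/= big_geq.
    by rewrite vS IH /series/= big_nat_recr.
  rewrite vE; apply: normed_cvg.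
  apply: (@series_le_cvg _ _ (geometric M 2^-1)) => [n|n|n|].
  - exact: normr_ge0.
  - by rewrite /= mulr_ge0// (le_trans _ (CM _ (C0n _ _ (Cg n)))).
  - rewrite /= normrZ gtr0_norm// mulrC ler_pM2r//.
    by apply: CM; exact: C0n (Cg n).
  - by apply: is_cvg_geometric_series; rewrite ger0_norm; lra.
pose w := limn v.
have vw : v n @[n --> \oo] --> w by exact: vcvg.
have hvw := sublinear_cvg L0 subh hL vw.
have hw : h w <= - c.
  apply: (cvgr_to_le hvw); exists 1%N => // -[//|n] _.
  change (h (v n.+1) <= - c); elim: n => [|n IH].
    have -> : v 1%N = g 0%N by rewrite vS /q expr0 scale1r add0r.
    exact: hc.
  rewrite vS (le_trans (hD _ _))// (hZ _ _ (ltW (q0 _))).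
  have : q n.+1 * h (g n.+1) <= 0.
    have := hc _ (C0n _ _ (Cg n.+1)) => hg.
    by rewrite pmulr_rle0//; lra.
  lra.
(* Compare the tails of h and of b along v beyond N. *)
have [b Bb bw] := attain w ltac:(lra).
have [N bN] := Bt b Bb.
have hN : (s - th) * 2 * q N <= h w - h (v N).
  apply: (geometric_increment_le _ hvw) => n _.
  have := incr n; have : 0 <= th * q n * q n.
    exact: mulr_ge0 (mulr_ge0 (ltW th0) (ltW (q0 n))) (ltW (q0 n)).
  rewrite -/(q n); lra.
have bvw : - b (v n) @[n --> \oo] --> - b w.
  by apply: (@cvgN _ R^o); apply: cvg_comp vw _; exact: dual_continuous.
have bN' : (- t) * 2 * q N <= - b w - - b (v N).
  apply: (geometric_increment_le _ bvw) => n Nn.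
  have bg : b (g n) <= t by apply: bN; exact: Cdecr Nn _ (Cg n).
  rewrite vS linearD linearZ /= -/(q n).
  have : q n * b (g n) <= q n * t by rewrite ler_pM2l.
  rewrite /GRing.scale/=; lra.
have bvN := Bh b (v N) Bb.
rewrite -bw in hN.
have : (s - th - t) * (2 * q N) <= 0 by lra.
rewrite pmulr_lle0 ?mulr_gt0// /th; lra.
Qed.

(** * Perturbing a point where the support function is negative *)

(** One step, from a to a + r, uses the Lipschitz bound to remain in the region
h < 0 and Simons' inequality to come back from h x0 / 4 to h x0 / 2.  The length r
depends only on h x0, L and M, so finitely many steps reach T. *)
Lemma sublinear_perturbation_neg (R : realType) (E : completeNormedModType R)
    (h : E -> R) (L : R) (B : set (dual E)) (C : nat -> set E) (M : R) (x0 : E) :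
  0 <= L -> sublinear h -> (forall x, h x <= L * `|x|) ->
  (forall b x, B b -> b x <= h x) ->
  (forall x, h x < 0 -> exists2 b, B b & b x = h x :> R) ->
  (forall n, @convex_set R E (C n)) -> (forall n, C n !=set0) ->
  (forall m n, (m <= n)%N -> C n `<=` C m) ->
  (forall x, C 0%N x -> `|x| <= M) ->
  (forall b e, B b -> 0 < e -> exists N, forall x, C N x -> b x <= e) ->
  h x0 < 0 ->
  forall (T : R) (N : nat), 0 <= T ->
    exists2 y, C N y & h (x0 + T *: y) <= h x0 / 2.
Proof.
move=> L0 subh hL Bh attain cC C0 Cdecr CM Bnull hx0 T N T0.
have [hD hZ] := subh.
have M0 : 0 <= M by have [y /CM] := C0 0%N; exact: le_trans.
have step (a r : R) : 0 <= a -> 0 <= r -> r * (L * M) <= - h x0 / 4 ->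
    (forall N, exists2 y, C N y & h (x0 + a *: y) <= h x0 / 2) ->
    (forall N, exists2 y, C N y & h (x0 + (a + r) *: y) <= h x0 / 2).
  move=> a0 r0 rLM IH {}N.
  pose f (y : E) := x0 + (a + r) *: y.
  have ar0 : 0 <= a + r by rewrite addr_ge0.
  pose Y n := [set y | C (N + n)%N y /\ h (x0 + a *: y) <= h x0 / 2].
  have YM n y : Y n y -> `|y| <= M by move=> [Cy _]; apply: CM; exact: Cdecr Cy.
  have cZ n : @convex_set R E (f @` Y n).
    apply/convex_setP => _ _ p p' p0 p'0 pp' [y [Cy hy] <-] [y' [Cy' hy'] <-].
    have -> : p *: f y + p' *: f y' = f (p *: y + p' *: y').
      rewrite /f !scalerDr addrACA -scalerDl pp' scale1r.
      by rewrite !scalerA (mulrC p) (mulrC p').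
    exists (p *: y + p' *: y') => //; split.
      by move/convex_setP : (cC (N + n)%N); exact.
    have -> : x0 + a *: (p *: y + p' *: y') =
        p *: (x0 + a *: y) + p' *: (x0 + a *: y').
      rewrite !scalerDr [RHS]addrACA -scalerDl pp' scale1r.
      by rewrite !scalerA (mulrC p) (mulrC p').
    rewrite (le_trans (hD _ _))// !hZ//.
    exact: convex_comb_le.
  (* b is at most about h x0 on f @` Y n for n large; the threshold 3/4 lies
     strictly between this value and the target h x0 / 2. *)
  have [_ [y [Cy _] <-] hfy] : exists2 z, (f @` Y 0%N) z & h z < h x0 / 2.
    apply: (@simons_inequality _ _ h L B (fun n => f @` Y n)
        (`|x0| + (a + r) * M) (- h x0 / 4) (h x0 * (3 / 4)) (h x0 / 2)) => //.
    - move=> n; have [y Cy hy] := IH (N + n)%N.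
      by exists (f y); exists y.
    - move=> m n mn _ [y [Cy hy] <-]; exists y => //; split=> //.
      by apply: Cdecr Cy; rewrite leq_add2l.
    - move=> _ [y /(YM 0%N) yM <-]; rewrite (le_trans (ler_normD _ _))// lerD2l.
      by rewrite normrZ ger0_norm// ler_wpM2l.
    - by lra.
    - move=> _ [y Yy <-]; rewrite /f scalerDl addrA (le_trans (hD _ _))//.
      have [_ hy] := Yy; rewrite (hZ _ _ r0).
      have : h y <= L * M by rewrite (le_trans (hL y))// ler_wpM2l// (YM 0%N).
      move=> /(ler_wpM2l r0); lra.
    - move=> b Bb.
      have e0 : 0 < - h x0 / (4 * (a + r + 1)).
        by rewrite divr_gt0 ?oppr_gt0// mulr_gt0//; lra.
      have [n bn] := Bnull b _ Bb e0.
      exists n => _ [y [Cy _] <-].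
      have by_ : b y <= - h x0 / (4 * (a + r + 1)).
        by apply: bn; apply: Cdecr Cy; exact: leq_addl.
      have -> : b (f y) = b x0 + (a + r) * b y :> R by rewrite linearD linearZ.
      have bx0 := Bh b x0 Bb.
      have : (a + r) * b y <= (a + r) * (- h x0 / (4 * (a + r + 1))).
        by rewrite ler_wpM2l.
      have : (a + r) * (- h x0 / (4 * (a + r + 1))) <= - h x0 / 4.
        rewrite mulrA ler_pdivrMr; nra.
      lra.
    - by lra.
  by exists y; [move: Cy; rewrite addn0|exact: ltW].
have [k kP] : exists k : nat, T * (L * M) / (- h x0 / 4) < k.+1%:R.
  exists (Num.bound (T * (L * M) / (- h x0 / 4))).
  apply: lt_trans (_ : (Num.bound (T * (L * M) / (- h x0 / 4)))%:R < _).
    by apply: archi_boundP; rewrite divr_ge0 ?mulr_ge0//; lra.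
  by rewrite ltr_nat.
have hx04 : 0 < - h x0 / 4 by lra.
pose r := T / k.+1%:R.
have r0 : 0 <= r by rewrite divr_ge0.
have rLM : r * (L * M) <= - h x0 / 4.
  move: kP; rewrite ltr_pdivrMr// => kP.
  by rewrite /r mulrAC ler_pdivrMr// mulrC ltW// mulrC [ltRHS]mulrC.
have -> : T = k.+1%:R * r by rewrite /r mulrC divfK.
elim: k.+1 N => [|j IH] {}N.
  have [y Cy] := C0 N; exists y => //; rewrite mul0r scale0r addr0; lra.
rewrite -natr1 mulrDl mul1r.
by apply: step => //; rewrite mulr_ge0.
Qed.

(** * Convergence on the weak-star closed convex hull *)

Lemma weak_star_closure_hull_le (R : realType) (E : normedModType R)
    (B : set (dual E)) (x : E) (r : R) :
  (forall b, B b -> b x <= r) ->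
  forall k, weak_star_closure (convex_hull B) k -> k x <= r.
Proof.
move=> Br k Kk; rewrite leNgt; apply/negP => rk.
have [f Bf /(_ x)] := (weak_star_closureP _ _).1 Kk [:: x] (k x - r)
  ltac:(by rewrite subr_gt0).
have : f x <= r.
  apply: (Bf [set f : dual E | f x <= r]); split; last exact: Br.
  apply/convex_setP => g g' a b a0 b0 ab /= gr g'r.
  exact: convex_comb_le.
rewrite inE eqxx => fr /(_ isT); rewrite ltr_norml => /andP[]; lra.
Qed.

Lemma weak_star_closure_hull_bounded (R : realType) (E : normedModType R)
    (B : set (dual E)) (L : R) :
  (forall b, B b -> dual_norm b <= L) ->
  forall k x, weak_star_closure (convex_hull B) k -> `|k x| <= L * `|x|.
Proof.
move=> BL k x Kk.
have ub y : k y <= L * `|y|.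
  apply: (@weak_star_closure_hull_le _ _ B) => // b Bb.
  rewrite (le_trans (ler_norm _))// (le_trans (dual_norm_ub b y))//.
  by rewrite ler_wpM2r// BL.
by rewrite ler_norml ub lerNl andbT; have := ub (- x); rewrite linearN normrN.
Qed.

(** One half of convergence to 0 on K; the other half is the same statement for
the sequence - u.  The perturbation of x0 is made along the convex hulls of those
u n at which k is at least e, since k >= e persists on these hulls. *)
Lemma closed_hull_eventually_lt (R : realType) (E : completeNormedModType R)
    (B : set (dual E)) (K := weak_star_closure (convex_hull B)) :
  bounded_set B -> ~ K 0 ->
  (forall x : E, L_ K x ->
    exists2 b : dual E, B b &
      (b x)%:E = sup_on B x /\ sup_on B x = sup_on K x) ->
  forall (u : nat -> E) (M : R), (forall n, `|u n| <= M) ->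
  (forall b, B b -> b (u n) @[n --> \oo] --> (0 : R)) ->
  forall k (e : R), K k -> 0 < e -> \forall n \near \oo, k (u n) < e.
Proof.
move=> /pinfty_ex_gt0[L L0 /= BL] K0 attainB u M uM uB k e Kk e0.
have KL := @weak_star_closure_hull_bounded _ _ _ _ BL.
have BK : B `<=` K.
  by move=> b Bb; apply: sub_weak_star_closure; exact: sub_smallest Bb.
pose V x := [set (f x : R) | f in K].
have Vsup x : has_sup (V x).
  split; first by exists (k x); exists k.
  by exists (L * `|x|) => _ [f Kf <-]; rewrite (le_trans (ler_norm _))// KL.
pose h x := sup (V x).
have hK f x : K f -> f x <= h x.
  by move=> Kf; apply: sup_upper_bound => //; exists f.
have h_le x r : (forall f, K f -> f x <= r) -> h x <= r.
  move=> Kr; apply: ge_sup; first by case: (Vsup x).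
  by move=> _ [f Kf <-]; exact: Kr.
have hL x : h x <= L * `|x|.
  by apply: h_le => f Kf; rewrite (le_trans (ler_norm _))// KL.
have hZ_le a x : 0 <= a -> h (a *: x) <= a * h x.
  move=> a0; apply: h_le => f Kf; rewrite linearZ.
  by apply: ler_wpM2l => //; exact: hK.
have subh : sublinear h.
  split=> [x y|a x].
    by apply: h_le => f Kf; rewrite linearD; apply: lerD; exact: hK.
  rewrite le_eqVlt => /predU1P[<-|a0].
    rewrite scale0r mul0r; apply/le_anti/andP; split.
      by have := hL 0; rewrite normr0 mulr0.
    by have := hK k 0 Kk; rewrite linear0.
  apply/le_anti/andP; split; first exact: hZ_le (ltW a0).
  rewrite -ler_pdivlMl//.
  have := hZ_le a^-1 (a *: x); rewrite scalerA mulVf ?gt_eqF// scale1r.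
  by apply; rewrite invr_ge0 ltW.
have sup_onE x : sup_on K x = (h x)%:E.
  rewrite /sup_on -ereal_sup_EFin; [|by case: (Vsup x)|by case: (Vsup x)].
  by congr ereal_sup; rewrite image_comp.
have attain x : h x < 0 -> exists2 b : dual E, B b & b x = h x :> R.
  move=> hx; have [|b Bb [bx supB]] := attainB x.
    by left; split; [exists k|rewrite sup_onE lte_fin].
  by exists b => //; have := bx; rewrite supB sup_onE => -[].
have [x0 [d d0 x0d]] : exists x0 : E, exists2 d : R, 0 < d &
    forall f, convex_hull B f -> f x0 <= - d.
  apply: weak_star_separation => //; first exact: smallest_convex.
  move=> x; exists (L * `|x|) => f Bf; apply: KL.
  exact: sub_weak_star_closure.
have hx0 : h x0 < 0.
  rewrite (@le_lt_trans _ _ (- d)) ?oppr_lt0//.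
  apply: h_le; apply: weak_star_closure_hull_le => b Bb; apply: x0d.
  exact: sub_smallest Bb.
apply: contrapT => not_ev.
have often N : exists2 n, (N <= n)%N & e <= k (u n).
  apply: contrapT => noN; apply: not_ev; exists N => // n /= Nn.
  by rewrite ltNge; apply/negP => eku; apply: noN; exists n.
pose U N := [set u n | n in [set n | (N <= n)%N /\ e <= k (u n)]].
pose C N : set E := smallest (@convex_set R E) (U N).
have C_sub N (A : set E) : @convex_set R E A -> U N `<=` A -> C N `<=` A.
  exact: smallest_sub.
have Ck N y : C N y -> e <= k y.
  apply: (C_sub N [set y | e <= k y]) => [|_ [n [_ ek] <-]//].
  apply/convex_setP => x x' a b a0 b0 ab /= ex ex'.
  by rewrite dual_comb -lerN2 opprD -!mulrN convex_comb_le// lerN2.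
have := hK k x0 Kk => kx0.
(* The size at which k x0 + T * k y >= 0 for all y with e <= k y. *)
pose T := - k x0 / e.
have T0 : 0 <= T by rewrite divr_ge0 ?ltW// oppr_gt0; exact: le_lt_trans hx0.
have [y Cy] : exists2 y, C 0%N y & h (x0 + T *: y) <= h x0 / 2.
  apply: (@sublinear_perturbation_neg _ _ h L B C M) => //.
  - exact: ltW.
  - by move=> b x /BK; exact: hK.
  - by move=> N; exact: smallest_convex.
  - move=> N; have [n Nn en] := often N; exists (u n).
    by apply: (@sub_smallest _ _ _ (U N)) => //; exists n.
  - move=> m n mn; apply: C_sub; first exact: smallest_convex.
    move=> _ [i [ni ei] <-]; apply: (@sub_smallest _ _ _ (U m)) => //.
    by exists i => //; split=> //; exact: leq_trans mn ni.
  - apply: (C_sub _ [set x | `|x| <= M]) => [|_ [n _ <-]]; last exact: uM.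
    apply/convex_setP => x x' a b a0 b0 ab /= xM x'M.
    rewrite (le_trans (ler_normD _ _))// !normrZ !ger0_norm//.
    exact: convex_comb_le.
  - move=> b r Bb r0; have /cvgr0Pnorm_lt/(_ r r0)[N _ bN] := uB b Bb.
    exists N; apply: (C_sub _ [set x | b x <= r]) => [|_ [n [Nn _] <-] /=].
      apply/convex_setP => x x' a a' a0 a'0 aa' /= xr x'r.
      rewrite dual_comb; exact: convex_comb_le.
    by rewrite (le_trans (ler_norm _))// ltW// bN.
have := hK k (x0 + T *: y) Kk.
have -> : k (x0 + T *: y) = k x0 + T * k y :> R by rewrite linearD linearZ.
have : T * e <= T * k y by rewrite ler_wpM2l// (Ck 0%N).
rewrite /T divfK ?gt_eqF//; lra.
Qed.

Theorem theorem8 (R : realType) (E : completeNormedModType R)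
    (B : set (dual E)) :
  let K := weak_star_closure (convex_hull B) in
  bounded_set B ->
  ~ K 0 ->
  (forall x : E, L_ K x ->
    exists2 b : dual E, B b &
      (b x)%:E = sup_on B x /\ sup_on B x = sup_on K x) ->
  forall x_ : nat -> E,
  bounded_fun x_ ->
  (x_ : nat -> weak_on B) @ \oo --> ((0 : E) : weak_on B) ->
  (x_ : nat -> weak_on K) @ \oo --> ((0 : E) : weak_on K).
Proof.
move=> K Bb K0 attain x_ /pinfty_ex_gt0[M M0 /= xM] /cvg_weak_onP xB.
have xM' n : `|x_ n| <= M by exact: xM.
have xB0 b : B b -> b (x_ n) @[n --> \oo] --> (0 : R).
  by move=> /xB; rewrite linear0.
apply/cvg_weak_onP => k Kk; rewrite linear0; apply/cvgr0Pnorm_lt => e e0.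
have pos := closed_hull_eventually_lt Bb K0 attain xM' xB0 Kk e0.
have neg : \forall n \near \oo, k (- x_ n) < e.
  apply: (closed_hull_eventually_lt Bb K0 attain _ _ Kk e0) => [n|b /xB0 bx].
    by rewrite normrN; exact: xM'.
  rewrite -[0 in X in _ --> X]oppr0; under eq_fun do rewrite linearN.
  exact: (@cvgN _ R^o).
apply: filterS2 pos neg => n kx; rewrite linearN => kNx.
by rewrite ltr_norml; apply/andP; split=> //; rewrite ltrNl.
Qed.
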